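(* Let $N\ge 20$ and let $\mathbf D=[d(i,j,k,\ell)]\in\mathbb R^{N\times N\times N\times N}$ be a degenerate tensor. Let $\pi$ be uniformly distributed over $\mathcal S_N$. Let $I$ and $J$ be independently and uniformly distributed over all subsets of $[N]$ of size $N_1=\lceil N/2\rceil$. Given $(I,J)$, let $\pi_1$ be uniformly distributed over all bijections from $I$ to $J$ and let $\pi_2$ be uniformly distributed over all bijections from $I^c$ to $J^c$, independent of $\pi_1$. Then, for any $\lambda\ge 0$, $$\mathrm E\Big[\exp\Big(\lambda\Big(\sum_{i\ne j}d(i,j,\pi(i),\pi(j))-\mathrm E\Big[\sum_{i\ne j}d(i,j,\pi(i),\pi(j))\Big]\Big)\Big)\Big]$$ $$\le \exp\big(50\tilde V\lambda^2\big)\Big(\mathrm E\Big[\exp\Big\{9\lambda\sum_{i\in I,\,j\in I^c}\tilde d_{I,J}(i,j,\pi_1(i),\pi_2(j))\Big\}\Big]\Big)^{1/2},$$ where $$\tilde V:=\frac1{N^2}\sum_{i,j,k,\ell\in[N]}d(i,j,k,\ell)^2$$ and $\tilde d_{I,J}$ is the centralized version of $d$ restricted to $I\times I^c\times J\times J^c$ (defined in the context).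
   Context: $[N]=\{1,\dots,N\}$, $\mathcal S_N$ is the group of permutations of $[N]$, $I^c=[N]\setminus I$, and sums over $i\neq j$ range over ordered pairs of distinct $i,j\in[N]$. $\mathbf D$ is fixed (deterministic). A tensor $\mathbf D=[d(i,j,k,\ell)]$ is degenerate if for all $i,j,k,\ell\in[N]$, $$\sum_{\ell'=1}^N d(i,j,k,\ell')=\sum_{k'=1}^N d(i,j,k',\ell)=\sum_{j'=1}^N d(i,j',k,\ell)=\sum_{i'=1}^N d(i',j,k,\ell)=0.$$ For subsets $I,J\subset[N]$ of size $N_1$ and $(i,j,k,\ell)\in I\times I^c\times J\times J^c$, $\tilde d_{I,J}(i,j,k,\ell)$ is obtained by fully centering the restriction of $d$ in each of its four arguments: letting $P_1,P_2,P_3,P_4$ denote the operators on real functions on $I\times I^c\times J\times J^c$ that replace a function by its average over the first argument in $I$, the second in $I^c$, the third in $J$, the fourth in $J^c$, respectively (all other arguments fixed), $$\tilde d_{I,J}:=\sum_{S\subseteq\{1,2,3,4\}}(-1)^{|S|}\Big(\prod_{s\in S}P_s\Big)\,d\big|_{I\times I^c\times J\times J^c}.$$ That is, $d$, minus the four one-argument averages, plus the six two-argument averages, minus the four three-argument averages, plus the average over all four arguments. *)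

(* Defs.v *)
From HB Require Import structures.
From mathcomp Require Import all_boot all_order all_fingroup all_algebra.
From mathcomp Require Import boolp reals sequences exp.

Set Implicit Arguments.
Unset Strict Implicit.
Unset Printing Implicit Defensive.

Import Order.TTheory GRing.Theory Num.Theory.

Local Open Scope ring_scope.

(* Expectation of f(X) for X uniformly distributed over the finite set A. *)
Definition Eunif (R : realType) (T : finType) (A : {set T}) (f : T -> R) : R :=
  (\sum_(x in A) f x) / #|A|%:R.

Notation "\E_ ( x 'in' A ) F" := (Eunif A (fun x => F))
  (at level 34, F at level 35, x name, A at level 200,
   format "\E_ ( x  'in'  A )  F") : ring_scope.

Definition tensor (R : realType) (N : nat) : Type :=
  'I_N -> 'I_N -> 'I_N -> 'I_N -> R.

Definition degenerate (R : realType) (N : nat) (d : tensor R N) : Prop :=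
  forall i j k l : 'I_N,
    [/\ \sum_(l' < N) d i j k l' = 0,
        \sum_(k' < N) d i j k' l = 0,
        \sum_(j' < N) d i j' k l = 0
      & \sum_(i' < N) d i' j k l = 0].

Definition subsets_of_size (N m : nat) : {set {set 'I_N}} :=
  [set I : {set 'I_N} | #|I| == m]%SET.

Definition elt (N : nat) (I : {set 'I_N}) : finType := {i : 'I_N | i \in I}.

Definition bijections (A B : finType) : {set {ffun A -> B}} :=
  [set f : {ffun A -> B} | `[< bijective f >]]%SET.

Section Centering.
Variables (R : realType) (A B C E : finType).
Implicit Types (f : A -> B -> C -> E -> R) (S : {set 'I_4}).

Definition avg1 f : A -> B -> C -> E -> R :=
  fun _ b c e => (\sum_(a : A) f a b c e) / #|A|%:R.

Definition avg2 f : A -> B -> C -> E -> R :=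
  fun a _ c e => (\sum_(b : B) f a b c e) / #|B|%:R.

Definition avg3 f : A -> B -> C -> E -> R :=
  fun a b _ e => (\sum_(c : C) f a b c e) / #|C|%:R.

Definition avg4 f : A -> B -> C -> E -> R :=
  fun a b c _ => (\sum_(e : E) f a b c e) / #|E|%:R.

(* The product of the averaging operators in S; the arguments are numbered
   from 0, and the order of composition is immaterial since they commute. *)
Definition avg S f : A -> B -> C -> E -> R :=
  (if (0 : 'I_4) \in S then avg1 else id)
    ((if (1 : 'I_4) \in S then avg2 else id)
      ((if (2 : 'I_4) \in S then avg3 else id)
        ((if (3 : 'I_4) \in S then avg4 else id) f))).

Definition centralize f : A -> B -> C -> E -> R :=
  fun a b c e => \sum_(S : {set 'I_4}) (-1) ^+ #|S| * avg S f a b c e.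

End Centering.

Definition dtilde (R : realType) (N : nat) (d : tensor R N) (I J : {set 'I_N}) :
    elt I -> elt (~: I) -> elt J -> elt (~: J) -> R :=
  centralize (fun (i : elt I) (j : elt (~: I)) (k : elt J) (l : elt (~: J)) =>
                d (val i) (val j) (val k) (val l)).

Definition perm_stat (R : realType) (N : nat) (d : tensor R N) (p : 'S_N) : R :=
  \sum_(i < N) \sum_(j < N | j != i) d i j (p i) (p j).

Definition split_stat (R : realType) (N : nat) (d : tensor R N)
    (I J : {set 'I_N}) (p1 : {ffun elt I -> elt J})
    (p2 : {ffun elt (~: I) -> elt (~: J)}) : R :=
  \sum_(i : elt I) \sum_(j : elt (~: I)) dtilde d i j (p1 i) (p2 j).

Definition Vtilde (R : realType) (N : nat) (d : tensor R N) : R :=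
  (\sum_(i < N) \sum_(j < N) \sum_(k < N) \sum_(l < N) d i j k l ^+ 2)
    / N%:R ^+ 2.

(* Main.v *)
Require Import Defs.
From mathcomp Require Import all_boot all_order all_fingroup all_algebra.
From mathcomp Require Import boolp reals sequences exp.
From mathcomp Require Import classical_sets topology normedtype derive ring lra zify.
From mathcomp Require Import fintype finset.

Set Implicit Arguments.
Unset Strict Implicit.
Unset Printing Implicit Defensive.

Import Order.TTheory GRing.Theory Num.Theory.
Import numFieldNormedType.Exports.

Local Open Scope ring_scope.

(* Couple the two sides: for a uniform permutation [s] and an independent uniform set [I],
   the pair (s restricted to I, s restricted to the complement) given [J = s @: I] has the
   law of (pi_1, pi_2).  Let S(I, s) be the corresponding value of [split_stat].  Its mean
   over [I] with [s] fixed is, by degeneracy,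
     alpha * perm_stat s + beta * diag_stat s + gamma * swap_stat s + constant,
   where alpha is about 1/4, beta is O(1/N) and gamma is O(1/N^2).  Solving for
   [perm_stat], Cauchy-Schwarz separates S from the two remaining statistics.
   For S, Jensen's inequality in [I] gives the factor 2/alpha <= 9, which may be increased
   to 9 because S is centered.  The remainder is sub-Gaussian: diag_stat / N is a linear
   permutation statistic whose matrix has squared Hilbert-Schmidt norm at most Vtilde, and
   swap_stat / N^2 is bounded by the square root of Vtilde. *)

(** * Exponential inequalities for uniform expectations *)

Lemma ler_deriv_ge0 (R : realType) (f f' : R -> R)
    (df : forall x : R, is_derive x 1 f (f' x)) (f'_ge0 : forall x, 0 <= x -> 0 <= f' x)
    (x : R) :
  0 <= x -> f 0 <= f x.
Proof.
rewrite le_eqVlt => /predU1P[<-//|x_gt0].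
have fc : {within `[0, x], continuous f}%classic.
  by apply: derivable_within_continuous => y _; have [] := df y.
have [c + fE] := @MVT R f f' 0 x x_gt0 (fun y _ => df y) fc.
rewrite in_itv /= => /andP[c_gt0 _].
by rewrite -subr_ge0 fE mulr_ge0 ?f'_ge0 ?subr0 ?ltW.
Qed.

(** For b >= 0 the function cosh x * exp (- x^2 / 2) is nonincreasing on [0, b]: its derivative has
    the sign opposite to [(1 + x) * expR (- x) - (1 - x) * expR x], which vanishes at 0 and is
    itself nondecreasing. Negative b follow by symmetry. *)
Lemma cosh_le (R : realType) (b : R) :
  (expR b + expR (- b)) / 2 <= expR (b ^+ 2 / 2).
Proof.
wlog b_ge0 : b / 0 <= b => [hw|].
  have [|/ltW b_le0] := leP 0 b; first exact: hw.
  by have := hw (- b); rewrite sqrrN opprK [_ + expR b]addrC; apply; rewrite oppr_ge0.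
have step1 (x : R) : 0 <= x -> 0 <= (1 + x) * expR (- x) - (1 - x) * expR x.
  move=> x_ge0.
  have := @ler_deriv_ge0 R (fun x => (1 + x) * expR (- x) - (1 - x) * expR x)
    (fun x => x * (expR x - expR (- x))).
  rewrite addr0 subr0 oppr0 expR0 mul1r subrr; apply=> // [y|y y_ge0].
    apply: is_derive_eq.
    rewrite /GRing.scale /=; ring.
  by rewrite mulr_ge0 // subr_ge0 ler_expR; lra.
pose f (x : R) := - (expR (x - x ^+ 2 / 2) + expR (- x - x ^+ 2 / 2)).
have : f 0 <= f b.
  apply: (@ler_deriv_ge0 R f (fun x =>
      ((1 + x) * expR (- x) - (1 - x) * expR x) * expR (- (x ^+ 2 / 2)))) => //.
    move=> x; rewrite /f; apply: is_derive_eq.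
    by rewrite !expRD /GRing.scale /=; field.
  move=> x x_ge0; apply: mulr_ge0; [exact: step1|exact: expR_ge0].
rewrite /f expr0n /= mul0r !subr0 oppr0 expR0 lerN2 !expRD expRN => h.
by rewrite ler_pdivrMr // mulrC -ler_pdivrMr ?expR_gt0 // mulrDl.
Qed.

Lemma expR_tangent (R : realType) (m x : R) : expR m * (1 + (x - m)) <= expR x.
Proof. by rewrite -[x in leRHS](subrKC m) expRD ler_pM2l ?expR_gt0 ?expR_ge1Dx. Qed.

Lemma expR_convex (R : realType) (r x y : R) :
  0 <= r <= 1 -> expR (r * x + (1 - r) * y) <= r * expR x + (1 - r) * expR y.
Proof.
move=> /andP[r_ge0 r_le1]; set m := r * x + _.
have -> : expR m = r * (expR m * (1 + (x - m))) + (1 - r) * (expR m * (1 + (y - m))).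
  by rewrite /m; ring.
by apply: lerD; apply: ler_wpM2l; rewrite ?subr_ge0 ?expR_tangent.
Qed.

Section UniformExpectation.
Variables (R : realType) (T : finType) (A : {set T}).
Implicit Types (f g : T -> R) (c : R).

Lemma eq_Eunif f g : {in A, f =1 g} -> Eunif A f = Eunif A g.
Proof. by move=> fg; congr (_ / _); apply: eq_bigr. Qed.

Lemma EunifD f g : Eunif A (fun x => f x + g x) = Eunif A f + Eunif A g.
Proof. by rewrite /Eunif big_split mulrDl. Qed.

Lemma EunifZ c f : Eunif A (fun x => c * f x) = c * Eunif A f.
Proof. by rewrite /Eunif -mulr_sumr mulrA. Qed.

Lemma Eunif_sum (I : Type) (s : seq I) (P : pred I) (F : I -> T -> R) :
  Eunif A (fun x => \sum_(i <- s | P i) F i x) = \sum_(i <- s | P i) Eunif A (F i).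
Proof. by rewrite /Eunif exchange_big mulr_suml. Qed.

Lemma Eunif_le f g : {in A, forall x, f x <= g x} -> Eunif A f <= Eunif A g.
Proof. by move=> fg; rewrite ler_wpM2r ?invr_ge0 ?ler0n // ler_sum. Qed.

Lemma Eunif_ge0 f : {in A, forall x, 0 <= f x} -> 0 <= Eunif A f.
Proof. by move=> f_ge0; rewrite divr_ge0 ?ler0n // sumr_ge0. Qed.

(** Lagrange's identity: after clearing denominators, the right side minus the left is a double sum
    of squares. *)
Lemma Eunif_CauchySchwarz f g :
  Eunif A (fun x => f x * g x) ^+ 2
    <= Eunif A (fun x => f x ^+ 2) * Eunif A (fun x => g x ^+ 2).
Proof.
rewrite /Eunif expr_div_n mulf_div -expr2 ler_wpM2r ?invr_ge0 ?exprn_ge0 ?ler0n //.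
rewrite -subr_ge0.
suff <- : \sum_(x in A) \sum_(y in A) (f x * g y - f y * g x) ^+ 2 / 2
    = (\sum_(x in A) f x ^+ 2) * (\sum_(x in A) g x ^+ 2)
      - (\sum_(x in A) f x * g x) ^+ 2.
  by do 2!apply: sumr_ge0 => ? _; rewrite divr_ge0 ?sqr_ge0.
set F := \sum_(x in A) f x ^+ 2; set G := \sum_(x in A) g x ^+ 2.
set H := \sum_(x in A) f x * g x.
transitivity (\sum_(x in A) ((f x ^+ 2 * G + g x ^+ 2 * F) / 2 - f x * g x * H)).
  apply: eq_bigr => x _; rewrite /F /G /H !mulr_sumr -big_split mulr_suml -sumrB.
  by apply: eq_bigr => y _ /=; field.
rewrite sumrB -mulr_suml -[\sum_(x in A) f x * g x * H]mulr_suml big_split /=.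
by rewrite -!mulr_suml -/F -/G -/H; field.
Qed.

Hypothesis A_neq0 : A != finset.set0.

Let cardA_neq0 : #|A|%:R != 0 :> R.
Proof. by rewrite pnatr_eq0 cards_eq0. Qed.

Lemma Eunif_cst c : Eunif A (fun=> c) = c.
Proof. by rewrite /Eunif sumr_const -[c *+ _]mulr_natr mulfK. Qed.

Lemma Eunif_center f : Eunif A (fun x => f x - Eunif A f) = 0.
Proof. by rewrite EunifD (Eunif_cst (- _)) subrr. Qed.

(** Jensen's inequality, by averaging the tangent line of exp at the mean of [f]. *)
Lemma Eunif_expR_ge f : expR (Eunif A f) <= Eunif A (fun x => expR (f x)).
Proof.
set m := Eunif A f.
apply: le_trans (_ : Eunif A (fun x => expR m * (1 + (f x - m))) <= _).
  by rewrite EunifZ EunifD Eunif_center Eunif_cst addr0 mulr1.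
by apply: Eunif_le => x _; apply: expR_tangent.
Qed.

(** Write E for the right side. Convexity between [f x] and 0 bounds the left side by r * E + (1 -
    r), and E >= 1 by Jensen. This is what allows a factor in the exponent to be increased. *)
Lemma Eunif_expR_mono f (r : R) : Eunif A f = 0 -> 0 <= r <= 1 ->
  Eunif A (fun x => expR (r * f x)) <= Eunif A (fun x => expR (f x)).
Proof.
move=> f0 r01; have [r_ge0 r_le1] := andP r01.
have ge1 : 1 <= Eunif A (fun x => expR (f x)).
  by rewrite -expR0 -f0 Eunif_expR_ge.
apply: le_trans (_ : r * Eunif A (fun x => expR (f x)) + (1 - r) <= _).
  rewrite -EunifZ -(Eunif_cst (1 - r)) -EunifD; apply: Eunif_le => x _.
  by have := expR_convex (f x) 0 r01; rewrite mulr0 addr0 expR0 mulr1.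
nra.
Qed.

(** Hoeffding's lemma: on [-b, b] the exponential lies below its chord, whose mean is cosh b because
    [f] is centered. *)
Lemma Eunif_Hoeffding f (b : R) : Eunif A f = 0 -> {in A, forall x, `|f x| <= b} ->
  Eunif A (fun x => expR (f x)) <= expR (b ^+ 2 / 2).
Proof.
move=> f0 fb; apply: le_trans (cosh_le b).
(* The chord needs b > 0; otherwise [f] vanishes on [A]. *)
have [b_gt0|b_le0] := ltP 0 b; last first.
  have fx0 x : x \in A -> f x = 0.
    by move=> /fb xb; apply/eqP; rewrite -normr_le0 (le_trans xb).
  rewrite (eq_Eunif (g := fun=> 1)) ?Eunif_cst => [|x /fx0->]; last by rewrite expR0.
  by have := expR_ge1Dx b; have := expR_ge1Dx (- b); lra.
(* These are cosh b and sinh b; the chord has intercept [ch] and slope [sh / b]. *)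
set ch := _ / 2; pose sh := (expR b - expR (- b)) / 2.
apply: le_trans (_ : Eunif A (fun x => sh / b * f x + ch) <= _); last first.
  by rewrite EunifD EunifZ f0 mulr0 add0r Eunif_cst.
apply: Eunif_le => x /fb; rewrite ler_norml => /andP[fx_ge fx_le].
pose r := (f x + b) / (2 * b).
have r01 : 0 <= r <= 1.
  by apply/andP; split; [apply: divr_ge0|rewrite ler_pdivrMr]; lra.
have -> : f x = r * b + (1 - r) * - b by rewrite /r; field; rewrite gt_eqF.
apply: le_trans (expR_convex _ _ r01) _.
by rewrite le_eqVlt; apply/orP; left; apply/eqP; rewrite /sh /ch /r; field;
   rewrite gt_eqF.
Qed.

End UniformExpectation.

Lemma Eunif_exchange (R : realType) (T U : finType) (A : {set T}) (B : {set U})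
    (F : T -> U -> R) :
  \E_(x in A) \E_(y in B) F x y = \E_(y in B) \E_(x in A) F x y.
Proof.
by rewrite /Eunif -!mulr_suml exchange_big /= mulrAC.
Qed.

(** * Linear permutation statistics *)

Lemma setT_neq0 (T : finType) (x : T) : [set: T] != finset.set0.
Proof. by apply/finset.set0Pn; exists x; rewrite inE. Qed.

Lemma sqr_sum_le (R : realType) (T : finType) (f : T -> R) :
  (\sum_x f x) ^+ 2 <= #|T|%:R * \sum_x f x ^+ 2.
Proof.
have [T0|T_neq0] := eqVneq #|T| 0.
  by rewrite T0 mul0r big1 ?expr0n // => x; case: (fintype0 x T0).
have N_gt0 : 0 < #|T|%:R :> R by rewrite ltr0n lt0n.
have := @Eunif_CauchySchwarz R T [set: T] f (fun=> 1).
rewrite expr1n Eunif_cst -?card_gt0 ?cardsT ?lt0n // mulr1 /Eunif cardsT.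
have E (g : T -> R) : \sum_(x in [set: T]) g x = \sum_x g x.
  by apply: eq_bigl => x; rewrite inE.
rewrite !E; under eq_bigr do rewrite mulr1.
rewrite expr_div_n ler_pdivrMr ?exprn_gt0 // => /le_trans; apply.
by rewrite le_eqVlt; apply/orP; left; apply/eqP; field; rewrite gt_eqF.
Qed.

(** Cauchy-Schwarz would give a further factor 1 / #|T|. Dropping it keeps the bound valid for empty
    [T], where the quotient by zero is 0. *)
Lemma sqr_mean_le (R : realType) (T : finType) (f : T -> R) :
  ((\sum_x f x) / #|T|%:R) ^+ 2 <= \sum_x f x ^+ 2.
Proof.
have s_ge0 : 0 <= \sum_x f x ^+ 2 by apply: sumr_ge0 => x _; apply: sqr_ge0.
have [T0|T_neq0] := eqVneq #|T| 0; first by rewrite T0 invr0 mulr0 expr0n.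
have N_ge1 : 1 <= #|T|%:R :> R by rewrite ler1n lt0n.
rewrite expr_div_n ler_pdivrMr ?exprn_gt0 ?(lt_le_trans ltr01) //.
apply: le_trans (sqr_sum_le f) _; rewrite mulrC ler_wpM2l //.
by rewrite expr2 ler_peMl // (le_trans ler01).
Qed.

(** Conditioning on the image of 0: the remaining values form a uniform permutation of [n]
    points. *)
Lemma Eunif_perm_recl (R : realType) (n : nat) (F : 'S_n.+1 -> R) :
  \E_(p in [set: 'S_n.+1]) F p
    = \E_(k in [set: 'I_n.+1]) \E_(s in [set: 'S_n]) F (lift_perm ord0 k s).
Proof.
pose h (ks : 'I_n.+1 * 'S_n) := lift_perm ord0 ks.1 ks.2.
have h_bij : bijective h.
  apply: inj_card_bij => [[k s] [k' s'] /permP hE|].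
    have kE : k = k' by have := hE ord0; rewrite /h !lift_perm_id.
    congr (_, _) => //; apply/permP => i; have := hE (lift ord0 i).
    by rewrite /h !lift_perm_lift kE => /lift_inj.
  by rewrite card_prod card_ord !card_Sn factS.
rewrite /Eunif -!mulr_suml !cardsT card_ord !card_Sn factS -mulrA -invfM -natrM.
congr (_ / _%:R); last by rewrite mulnC.
rewrite (reindex h) /=; last exact: onW_bij.
rewrite pair_big_dep /=; apply: eq_bigl => -[k s]; by rewrite !inE.
Qed.

Section LinearPermutationStatistic.
Variable R : realType.

Let bound (n : nat) := forall e : 'I_n -> 'I_n -> R,
  \E_(s in [set: 'S_n]) expR (\sum_i e i (s i) - (\sum_i \sum_j e i j) / n%:R)
    <= expR (\sum_i \sum_j e i j ^+ 2).

(** Induction step, conditioning on the image k of 0. Deleting row 0 and column k leaves a matrix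
    whose squares sum to at most [Q - q] and, since columns sum to zero, whose total is minus that
    of the rest of row 0. The induction hypothesis thus gives exp (Q - q) * exp (Y k), and
    Hoeffding's lemma for the centered [Y] contributes exp q. *)
Let bound_centered (n : nat) (e : 'I_n.+1 -> 'I_n.+1 -> R) :
  bound n -> (forall j, \sum_i e i j = 0) ->
  \E_(s in [set: 'S_n.+1]) expR (\sum_i e i (s i)) <= expR (\sum_i \sum_j e i j ^+ 2).
Proof.
move=> IHn e0; set Q := \sum_i _.
pose r := \sum_l e ord0 l; pose q := \sum_l e ord0 l ^+ 2.
(* [Y k] is the conditional mean of the statistic given [s ord0 = k]. *)
pose Y k := e ord0 k - (\sum_j e ord0 (lift k j)) / n%:R.
have liftE k (f : 'I_n.+1 -> R) : \sum_l f l = f k + \sum_j f (lift k j).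
  by rewrite (bigD1_ord k).
have IHk k : \E_(s in [set: 'S_n]) expR (\sum_i e i (lift_perm ord0 k s i))
    <= expR (Q - q) * expR (Y k).
  pose a i j := e (lift ord0 i) (lift k j).
  have aE : \sum_i \sum_j a i j = - \sum_j e ord0 (lift k j).
    rewrite exchange_big -sumrN; apply: eq_bigr => j _ /=.
    by have := e0 (lift k j); rewrite (liftE ord0) => /eqP; rewrite addr_eq0 => /eqP ->; rewrite opprK.
  have a2 : \sum_i \sum_j a i j ^+ 2 <= Q - q.
    rewrite /Q (liftE ord0) -/q addrC addKr; apply: ler_sum => i _.
    by rewrite (liftE k) lerDr sqr_ge0.
  apply: le_trans (_ : \E_(s in [set: 'S_n]) (expR (Y k)
      * expR (\sum_i a i (s i) - (\sum_i \sum_j a i j) / n%:R)) <= _).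
    apply: Eunif_le => s _; rewrite (liftE ord0) lift_perm_id -expRD aE ler_expR.
    under eq_bigr do rewrite lift_perm_lift.
    by rewrite le_eqVlt; apply/orP; left; apply/eqP; rewrite /Y /a; ring.
  rewrite EunifZ mulrC ler_wpM2r ?expR_ge0 // (le_trans (IHn a)) //.
  by rewrite ler_expR.
have Y_mean0 : Eunif [set: 'I_n.+1] Y = 0.
  rewrite /Eunif; apply/eqP; rewrite mulf_eq0; apply/orP; left; apply/eqP.
  under eq_bigl do rewrite inE.
  have YE k : Y k = e ord0 k * (1 + n%:R^-1) - r / n%:R.
    by rewrite /Y /r (liftE k); ring.
  under eq_bigr do rewrite YE.
  rewrite sumrB -mulr_suml -/r sumr_const card_ord -[_ *+ n.+1]mulr_natr.
  (* For n = 0 the division is by zero, but then [r] is the only column sum, hence 0. *)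
  have [n0|n_neq0] := eqVneq n 0.
    suff -> : r = 0 by rewrite !mul0r subrr.
    rewrite /r; subst n; rewrite big_ord_recl big_ord0 addr0 -[RHS](e0 ord0).
    by rewrite big_ord_recl big_ord0 addr0.
  by rewrite -[n.+1]addn1 natrD; field; rewrite pnatr_eq0.
(* From (x - t)^2 <= 2 (x^2 + t^2), where t^2 is at most the sum of the other squares in row 0. The
   bound sqrt (2 q) makes Hoeffding's exponent equal to q. *)
have Y_le k : `|Y k| <= Num.sqrt (2 * q).
  rewrite -sqrtr_sqr ler_wsqrtr // /q (liftE k).
  have := sqr_mean_le (fun j => e ord0 (lift k j)); rewrite card_ord /Y.
  set t := _ / _ => t_le; apply: le_trans (_ : 2 * (e ord0 k ^+ 2 + t ^+ 2) <= _).
    by rewrite -subr_ge0 (_ : _ - _ = (e ord0 k + t) ^+ 2) ?sqr_ge0 //; ring.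
  by rewrite ler_pM2l // lerD2l.
rewrite Eunif_perm_recl.
apply: le_trans (_ : expR (Q - q) * expR (Num.sqrt (2 * q) ^+ 2 / 2) <= _).
  apply: le_trans (_ : \E_(k in [set: 'I_n.+1]) (expR (Q - q) * expR (Y k)) <= _).
    by apply: Eunif_le => k _; apply: IHk.
  rewrite EunifZ ler_pM2l ?expR_gt0 // Eunif_Hoeffding //.
  exact: setT_neq0 ord0.
rewrite -expRD ler_expR sqr_sqrtr ?mulr_ge0 //; first lra.
by apply: sumr_ge0 => l _; apply: sqr_ge0.
Qed.

(* A large entry of [e] is seen with probability [1 / n] only, so the natural variance
   proxy would be smaller by a factor [n]; but no such sub-Gaussian bound holds. *)
Lemma Eunif_perm_linear_le (n : nat) (e : 'I_n -> 'I_n -> R) :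
  \E_(s in [set: 'S_n]) expR (\sum_i e i (s i) - (\sum_i \sum_j e i j) / n%:R)
    <= expR (\sum_i \sum_j e i j ^+ 2).
Proof.
elim: n e => [e|n IHn e].
  rewrite (eq_Eunif (g := fun=> 1)) => [|s _ /=]; last by rewrite !big_ord0 mul0r subrr expR0.
  by rewrite Eunif_cst ?big_ord0 ?expR0 // (setT_neq0 1%g).
(* Subtracting column means shifts the statistic by a constant, which is its mean, and can only
   decrease the sum of squares. *)
pose c j := (\sum_i e i j) / n.+1%:R.
have c_sum j : \sum_(i < n.+1) c j = \sum_i e i j.
  by rewrite sumr_const card_ord -[_ *+ _]mulr_natr divfK ?pnatr_eq0.
have -> : \E_(s in [set: 'S_n.+1])
      expR (\sum_i e i (s i) - (\sum_i \sum_j e i j) / n.+1%:R)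
    = \E_(s in [set: 'S_n.+1]) expR (\sum_i (e i (s i) - c (s i))).
  apply: eq_Eunif => s _ /=; rewrite sumrB exchange_big mulr_suml.
  by congr (expR (_ - _)); rewrite [LHS](reindex_perm s).
apply: le_trans (bound_centered (e := fun i j => e i j - c j) IHn _) _.
  move=> j /=; rewrite sumrB c_sum. by rewrite subrr.
rewrite ler_expR [leLHS]exchange_big [leRHS]exchange_big; apply: ler_sum => j _ /=.
rewrite -subr_ge0 -sumrB.
rewrite (eq_bigr (fun i => 2 * c j * e i j - c j * c j)) => [|i _]; last by ring.
rewrite sumrB -mulr_sumr -c_sum !sumr_const card_ord
  -[c j *+ _]mulr_natr -[(c j * c j) *+ _]mulr_natr.
rewrite (_ : _ - _ = c j ^+ 2 * n.+1%:R); last by ring.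
by rewrite mulr_ge0 ?sqr_ge0.
Qed.

End LinearPermutationStatistic.

(** * Moments of a uniform random subset *)

(** The probability that [a] given distinct points all lie in a uniform subset of size [m]. *)
Definition incl_prob (R : realType) (N m a : nat) : R := (m ^_ a)%:R / (N ^_ a)%:R.

(** For a <= m, both sides become N! after multiplication by (m - a)! (N - m)!; for a > m both
    vanish. *)
Lemma bin_sub_ffact (N m a : nat) :
  (m <= N -> a <= N -> 'C(N - a, N - m) * N ^_ a = 'C(N, m) * m ^_ a)%N.
Proof.
move=> mN aN; have [am|ma] := leqP a m; last first.
  by rewrite (ffact_small ma) muln0 bin_small //; lia.
apply/eqP; rewrite -(eqn_pmul2r (fact_gt0 (m - a))) -(eqn_pmul2r (fact_gt0 (N - m))).
rewrite -[('C(N, m) * _ * _)%N]mulnA ffact_fact // -[in eqbRHS]mulnA bin_fact //.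
have := bin_fact (leq_sub2l N am); rewrite (_ : N - a - (N - m) = m - a)%N; last lia.
move=> h; rewrite -(ffact_fact aN) -h; apply/eqP; lia.
Qed.

Section SubsetMoments.
Variables (R : realType) (N m : nat).
Hypothesis mN : (m <= N)%N.
Let q a : R := incl_prob R N m a.

Lemma card_subsets_of_size : #|subsets_of_size N m| = 'C(N, m).
Proof. by rewrite card_draws card_ord. Qed.

Lemma subsets_of_size_neq0 : subsets_of_size N m != finset.set0.
Proof. by rewrite -card_gt0 card_subsets_of_size bin_gt0. Qed.

Lemma Eunif_subset_incl (A : {set 'I_N}) :
  \E_(I in subsets_of_size N m) (A \subset I)%:R = q #|A|.
Proof.
have cA : (#|A| <= N)%N by rewrite -[leqRHS]card_ord max_card.
rewrite /Eunif card_subsets_of_size -natr_sum -big_mkcondr sum1_card.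
(* Complements of the sets counted here are the subsets of [~: A] of size N - m. *)
have -> : #|[pred I in subsets_of_size N m | A \subset I]| = 'C(N - #|A|, N - m).
  have <- : #|~: A| = (N - #|A|)%N by rewrite cardsCs setCK card_ord.
  rewrite -cards_draws -[RHS](card_preimset _ (@setC_inj _)); apply: eq_card => I.
  rewrite !inE setCS andbC; congr (_ && _).
  rewrite [#|~: I|]cardsCs setCK card_ord.
  have cI : (#|I| <= N)%N by rewrite -[leqRHS]card_ord max_card.
  by apply/eqP/eqP; lia.
apply/eqP; rewrite eqr_div ?pnatr_eq0 -?lt0n ?bin_gt0 ?ffact_gt0 //.
by rewrite -!natrM bin_sub_ffact // mulnC.
Qed.

Let cover_in (x : 'I_N) (A I : {set 'I_N}) : (x |: A \subset I) = (x \in I) && (A \subset I).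
Proof. by rewrite subUset sub1set. Qed.

(** Here and in the next two lemmas, the mean depends only on the number of distinct indices.
    Moebius inversion over set partitions of the indices writes it as a combination of equality
    indicators, so that sums can be treated one partition at a time. *)
Lemma Eunif_in2 (i j : 'I_N) :
  \E_(I in subsets_of_size N m) ((i \in I)%:R * (j \in I)%:R)
    = q 2 + (q 1 - q 2) * (i == j)%:R.
Proof.
transitivity (q #|i |: [set j]|).
  by rewrite -Eunif_subset_incl; apply: eq_Eunif => I _; rewrite cover_in sub1set -natrM mulnb.
rewrite cardsU1 cards1 inE; case: eqVneq => _ /=; ring.
Qed.

Lemma Eunif_in3 (i j k : 'I_N) :
  \E_(I in subsets_of_size N m) ((i \in I)%:R * (j \in I)%:R * (k \in I)%:R)
    = q 3 + (q 2 - q 3) * ((i == j)%:R + (i == k)%:R + (j == k)%:R)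
      + (q 1 - 3 * q 2 + 2 * q 3) * ((i == j)%:R * (j == k)%:R).
Proof.
transitivity (q #|i |: (j |: [set k])|).
  rewrite -Eunif_subset_incl; apply: eq_Eunif => I _.
  by rewrite !cover_in sub1set -!natrM !mulnb andbA.
rewrite !cardsU1 cards1 !inE.
case: (i =P j) => ij; case: (i =P k) => ik; case: (j =P k) => jk /=;
  try (exfalso; congruence); ring.
Qed.

Lemma Eunif_in4 (i j k l : 'I_N) :
  \E_(I in subsets_of_size N m)
      ((i \in I)%:R * (j \in I)%:R * (k \in I)%:R * (l \in I)%:R)
    = q 4 + (q 3 - q 4) * ((i == j)%:R + (i == k)%:R + (i == l)%:R
                           + (j == k)%:R + (j == l)%:R + (k == l)%:R)
      + (q 2 - 2 * q 3 + q 4)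
        * ((i == j)%:R * (k == l)%:R + (i == k)%:R * (j == l)%:R
           + (i == l)%:R * (j == k)%:R)
      + (q 2 - 3 * q 3 + 2 * q 4)
        * ((i == j)%:R * (j == k)%:R + (i == j)%:R * (j == l)%:R
           + (i == k)%:R * (k == l)%:R + (j == k)%:R * (k == l)%:R)
      + (q 1 - 7 * q 2 + 12 * q 3 - 6 * q 4)
        * ((i == j)%:R * (j == k)%:R * (k == l)%:R).
Proof.
transitivity (q #|i |: (j |: (k |: [set l]))|).
  rewrite -Eunif_subset_incl; apply: eq_Eunif => I _.
  by rewrite !cover_in sub1set -!natrM !mulnb !andbA.
rewrite !cardsU1 cards1 !inE.
case: (i =P j) => ij; case: (i =P k) => ik; case: (i =P l) => il;
  case: (j =P k) => jk; case: (j =P l) => jl; case: (k =P l) => kl /=;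
  try (exfalso; congruence); ring.
Qed.

Let sum_in (I : {set 'I_N}) (F : 'I_N -> R) :
  \sum_(i in I) F i = \sum_i (i \in I)%:R * F i.
Proof. by rewrite big_mkcond; apply: eq_bigr => i _; case: ifP; rewrite ?mul1r ?mul0r. Qed.

Let sum_delta (i : 'I_N) (F : 'I_N -> R) : \sum_j (i == j)%:R * F j = F i.
Proof.
rewrite (bigD1 i) //= eqxx mul1r big1 ?addr0 // => j /negPf ji.
by rewrite eq_sym ji mul0r.
Qed.

Lemma Eunif_sum_in2 (f : 'I_N -> 'I_N -> R) :
  \E_(I in subsets_of_size N m) (\sum_(i in I) \sum_(j in ~: I) f i j)
    = (q 1 - q 2) * \sum_i \sum_(j | j != i) f i j.
Proof.
(* The indicator of [i] is squared so that [Eunif_in2] covers both terms. *)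
transitivity (\sum_i \sum_j f i j * \E_(I in subsets_of_size N m)
    ((i \in I)%:R * (i \in I)%:R - (i \in I)%:R * (j \in I)%:R)).
  under eq_bigr => i _ do under eq_bigr => j _ do rewrite -EunifZ.
  under eq_bigr => i _ do rewrite -Eunif_sum.
  rewrite -Eunif_sum; apply: eq_Eunif => I _; rewrite sum_in.
  apply: eq_bigr => i _; rewrite sum_in mulr_sumr; apply: eq_bigr => j _.
  by rewrite inE; case: (i \in I); case: (j \in I); rewrite /=; ring.
rewrite mulr_sumr; apply: eq_bigr => i _; rewrite [in RHS]big_mkcond mulr_sumr.
apply: eq_bigr => j _ /=.
under eq_Eunif => I _ do rewrite -mulN1r.
rewrite EunifD EunifZ !Eunif_in2 eqxx eq_sym.
by case: eqP => _ /=; ring.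
Qed.

(** A weight that does not depend on [y], or not on [z], sums to zero. Only the partition joining
    [y] to [z] and the one-block partition survive. *)
Lemma Eunif_sum_in3 (h : 'I_N -> 'I_N -> 'I_N -> R)
    (h2 : forall x z, \sum_y h x y z = 0) (h3 : forall x y, \sum_z h x y z = 0) :
  \E_(I in subsets_of_size N m) (\sum_(x in I) \sum_(y in I) \sum_(z in I) h x y z)
    = (q 2 - q 3) * (\sum_x \sum_y h x y y)
      + (q 1 - 3 * q 2 + 2 * q 3) * \sum_x h x x x.
Proof.
transitivity (\sum_x \sum_y \sum_z h x y z * \E_(I in subsets_of_size N m)
    ((x \in I)%:R * (y \in I)%:R * (z \in I)%:R)).
  under eq_bigr => x _ do under eq_bigr => y _ do under eq_bigr => z _ do
    rewrite -EunifZ.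
  under eq_bigr => x _ do under eq_bigr => y _ do rewrite -Eunif_sum.
  under eq_bigr => x _ do rewrite -Eunif_sum.
  rewrite -Eunif_sum; apply: eq_Eunif => I _; rewrite sum_in.
  apply: eq_bigr => x _; rewrite sum_in mulr_sumr; apply: eq_bigr => y _.
  rewrite sum_in !mulr_sumr; apply: eq_bigr => z _; ring.
rewrite !mulr_sumr -big_split; apply: eq_bigr => x _ /=.
have Z2 (c : 'I_N -> R) : \sum_y \sum_z c z * h x y z = 0.
  by rewrite exchange_big big1 //= => z _; rewrite -mulr_sumr h2 mulr0.
have Z3 (c : 'I_N -> R) : \sum_y \sum_z c y * h x y z = 0.
  by rewrite big1 // => y _; rewrite -mulr_sumr h3 mulr0.
transitivity (\sum_y \sum_z (q 3 + (q 2 - q 3) * (x == y)%:R) * h x y z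
  + \sum_y \sum_z ((q 2 - q 3) * (x == z)%:R) * h x y z
  + (q 2 - q 3) * \sum_y \sum_z (y == z)%:R * h x y z
  + (q 1 - 3 * q 2 + 2 * q 3)
    * \sum_y \sum_z (x == y)%:R * ((y == z)%:R * h x y z)).
  rewrite !mulr_sumr -!big_split; apply: eq_bigr => y _ /=.
  rewrite !mulr_sumr -!big_split; apply: eq_bigr => z _ /=.
  by rewrite Eunif_in3; ring.
rewrite Z2 (Z3 (fun y => q 3 + (q 2 - q 3) * (x == y)%:R)) !add0r.
congr (_ * _ + _ * _); first by apply: eq_bigr => y _; rewrite sum_delta.
under eq_bigr => y _ do rewrite -mulr_sumr sum_delta.
by rewrite sum_delta.
Qed.

Lemma Eunif_sum_in4 (g : 'I_N -> 'I_N -> 'I_N -> 'I_N -> R)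
    (g1 : forall j k l, \sum_i g i j k l = 0) (g2 : forall i k l, \sum_j g i j k l = 0)
    (g3 : forall i j l, \sum_k g i j k l = 0) (g4 : forall i j k, \sum_l g i j k l = 0) :
  \E_(I in subsets_of_size N m)
      (\sum_(i in I) \sum_(j in I) \sum_(k in I) \sum_(l in I) g i j k l)
    = (q 2 - 2 * q 3 + q 4)
        * (\sum_i \sum_j g i i j j + \sum_i \sum_j g i j i j + \sum_i \sum_j g i j j i)
      + (q 1 - 7 * q 2 + 12 * q 3 - 6 * q 4) * \sum_i g i i i i.
Proof.
transitivity (\sum_i \sum_j \sum_k \sum_l g i j k l * \E_(I in subsets_of_size N m)
    ((i \in I)%:R * (j \in I)%:R * (k \in I)%:R * (l \in I)%:R)).
  under eq_bigr => i _ do under eq_bigr => j _ do under eq_bigr => k _ do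
    under eq_bigr => l _ do rewrite -EunifZ.
  under eq_bigr => i _ do under eq_bigr => j _ do under eq_bigr => k _ do
    rewrite -Eunif_sum.
  under eq_bigr => i _ do under eq_bigr => j _ do rewrite -Eunif_sum.
  under eq_bigr => i _ do rewrite -Eunif_sum.
  rewrite -Eunif_sum; apply: eq_Eunif => I _; rewrite sum_in.
  apply: eq_bigr => i _; rewrite sum_in mulr_sumr; apply: eq_bigr => j _.
  rewrite sum_in !mulr_sumr; apply: eq_bigr => k _.
  rewrite sum_in !mulr_sumr; apply: eq_bigr => l _; ring.
have Z1 (c : 'I_N -> 'I_N -> 'I_N -> R) :
    \sum_i \sum_j \sum_k \sum_l c j k l * g i j k l = 0.
  rewrite exchange_big big1 //= => j _; rewrite exchange_big big1 //= => k _.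
  by rewrite exchange_big big1 //= => l _; rewrite -mulr_sumr g1 mulr0.
have Z2 (c : 'I_N -> 'I_N -> 'I_N -> R) :
    \sum_i \sum_j \sum_k \sum_l c i k l * g i j k l = 0.
  rewrite big1 // => i _; rewrite exchange_big big1 //= => k _.
  by rewrite exchange_big big1 //= => l _; rewrite -mulr_sumr g2 mulr0.
have Z3 (c : 'I_N -> 'I_N -> 'I_N -> R) :
    \sum_i \sum_j \sum_k \sum_l c i j l * g i j k l = 0.
  rewrite big1 // => i _; rewrite big1 // => j _.
  by rewrite exchange_big big1 //= => l _; rewrite -mulr_sumr g3 mulr0.
have Z4 (c : 'I_N -> 'I_N -> 'I_N -> R) :
    \sum_i \sum_j \sum_k \sum_l c i j k * g i j k l = 0.
  rewrite big1 // => i _; rewrite big1 // => j _; rewrite big1 // => k _.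
  by rewrite -mulr_sumr g4 mulr0.
pose b2 := q 3 - q 4; pose b3 := q 2 - 3 * q 3 + 2 * q 4.
(* Every partition of the four indices with a singleton block contributes a weight
   that does not depend on one of the indices, hence vanishes by degeneracy. *)
transitivity (
  \sum_i \sum_j \sum_k \sum_l
    (b2 * ((j == k)%:R + (j == l)%:R + (k == l)%:R)
     + b3 * ((j == k)%:R * (k == l)%:R)) * g i j k l
  + \sum_i \sum_j \sum_k \sum_l
    (b2 * ((i == k)%:R + (i == l)%:R) + b3 * ((i == k)%:R * (k == l)%:R)) * g i j k l
  + \sum_i \sum_j \sum_k \sum_l
    (b2 * (i == j)%:R + b3 * ((i == j)%:R * (j == l)%:R)) * g i j k l
  + \sum_i \sum_j \sum_k \sum_l
    (q 4 + b3 * ((i == j)%:R * (j == k)%:R)) * g i j k l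
  + (q 2 - 2 * q 3 + q 4)
    * (\sum_i \sum_j \sum_k \sum_l (i == j)%:R * ((k == l)%:R * g i j k l)
       + \sum_i \sum_j \sum_k \sum_l (i == k)%:R * ((j == l)%:R * g i j k l)
       + \sum_i \sum_j \sum_k \sum_l (j == k)%:R * ((i == l)%:R * g i j k l))
  + (q 1 - 7 * q 2 + 12 * q 3 - 6 * q 4)
    * \sum_i \sum_j \sum_k \sum_l (i == j)%:R * ((j == k)%:R * ((k == l)%:R * g i j k l))).
  rewrite !mulrDr !mulr_sumr -!big_split; apply: eq_bigr => i _ /=.
  rewrite !mulr_sumr -!big_split; apply: eq_bigr => j _ /=.
  rewrite !mulr_sumr -!big_split; apply: eq_bigr => k _ /=.
  rewrite !mulr_sumr -!big_split; apply: eq_bigr => l _ /=.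
  by rewrite Eunif_in4 /b2 /b3; ring.
rewrite (Z1 (fun j k l => b2 * ((j == k)%:R + (j == l)%:R + (k == l)%:R)
     + b3 * ((j == k)%:R * (k == l)%:R))).
rewrite (Z2 (fun i k l => b2 * ((i == k)%:R + (i == l)%:R) + b3 * ((i == k)%:R * (k == l)%:R))).
rewrite (Z3 (fun i j l => b2 * (i == j)%:R + b3 * ((i == j)%:R * (j == l)%:R))).
rewrite (Z4 (fun i j k => q 4 + b3 * ((i == j)%:R * (j == k)%:R))) !add0r.
congr (_ * (_ + _ + _) + _ * _); apply: eq_bigr => i _.
- under eq_bigr => j _ do under eq_bigr => k _ do rewrite -mulr_sumr sum_delta.
  by under eq_bigr => j _ do rewrite -mulr_sumr; rewrite sum_delta.
- rewrite (eq_bigr (fun j => g i j i j)) // => j _.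
  by under eq_bigr => k _ do rewrite -mulr_sumr sum_delta; rewrite sum_delta.
- rewrite (eq_bigr (fun j => g i j j i)) // => j _.
  by under eq_bigr => k _ do rewrite -mulr_sumr sum_delta; rewrite sum_delta.
- under eq_bigr => j _ do under eq_bigr => k _ do rewrite -!mulr_sumr sum_delta.
  under eq_bigr => j _ do rewrite -mulr_sumr sum_delta.
  by rewrite sum_delta.
Qed.

Lemma Eunif_setC (F : {set 'I_N} -> R) :
  \E_(I in subsets_of_size N m) F (~: I) = \E_(I in subsets_of_size N (N - m)) F I.
Proof.
rewrite /Eunif card_subsets_of_size !card_draws card_ord bin_sub //; congr (_ / _).
rewrite [RHS](reindex_inj (@setC_inj _)); apply: eq_bigl => I; rewrite !inE.
rewrite [#|~: I|]cardsCs setCK card_ord.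
have cI : (#|I| <= N)%N by rewrite -[leqRHS]card_ord max_card.
by apply/eqP/eqP; lia.
Qed.

End SubsetMoments.

(** * Full centering *)

Section CentralizeFactorization.
Variables (R : realType) (A B C E : finType).
Implicit Types f g : A -> B -> C -> E -> R.

Let sub4 f g := fun a b c e => f a b c e - g a b c e.
Let center1 f := sub4 f (avg1 f).
Let center2 f := sub4 f (avg2 f).
Let center3 f := sub4 f (avg3 f).
Let center4 f := sub4 f (avg4 f).

Let avg1B f g : avg1 (sub4 f g) = sub4 (avg1 f) (avg1 g).
Proof.
by apply/funext=> a; apply/funext=> b; apply/funext=> c; apply/funext=> e;
   rewrite /sub4 /avg1 sumrB mulrBl.
Qed.

Let avg2B f g : avg2 (sub4 f g) = sub4 (avg2 f) (avg2 g).
Proof.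
by apply/funext=> a; apply/funext=> b; apply/funext=> c; apply/funext=> e;
   rewrite /sub4 /avg2 sumrB mulrBl.
Qed.

Let avg3B f g : avg3 (sub4 f g) = sub4 (avg3 f) (avg3 g).
Proof.
by apply/funext=> a; apply/funext=> b; apply/funext=> c; apply/funext=> e;
   rewrite /sub4 /avg3 sumrB mulrBl.
Qed.

Let avg2_avg3 f : avg2 (avg3 f) = avg3 (avg2 f).
Proof.
apply/funext=> a; apply/funext=> b; apply/funext=> c; apply/funext=> e.
by rewrite /avg2 /avg3 -!mulr_suml exchange_big mulrAC.
Qed.

(** Encoding the subsets of the four arguments by bits turns the sum over subsets into four nested
    sums over booleans. *)
Let set_of_bits (b : bool * bool * bool * bool) : {set 'I_4} :=
  [set i : 'I_4 | nth false [:: b.1.1.1; b.1.1.2; b.1.2; b.2] i].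

Let set_of_bits_bij : bijective set_of_bits.
Proof.
exists (fun S : {set 'I_4} => ((0 : 'I_4) \in S, (1 : 'I_4) \in S,
                               (2 : 'I_4) \in S, (3 : 'I_4) \in S)).
  by case=> [[[b0 b1] b2] b3]; rewrite !inE.
move=> S; apply/setP => i; rewrite inE.
by case: i => [[|[|[|[|//]]]] hi] /=; congr (_ \in S); apply/val_inj.
Qed.

Let card_set_of_bits b0 b1 b2 b3 :
  #|set_of_bits (b0, b1, b2, b3)| = (b0 + b1 + b2 + b3)%N.
Proof.
rewrite /set_of_bits cardsE -sum1_card big_mkcond !big_ord_recl big_ord0 /=.
by rewrite !unfold_in /=; case: b0; case: b1; case: b2; case: b3.
Qed.

(** Inclusion-exclusion: the alternating sum is the product of the operators 1 - P_s. Arguments 1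
    and 3 are grouped apart from 2 and 4 because [p1] links the first pair and [p2] the second. *)
Let centralizeE f :
  centralize f = center1 (center3 (center2 (center4 f))).
Proof.
have -> : center3 (center2 (center4 f)) = center2 (center3 (center4 f)).
  rewrite /center2 /center3 avg2B avg3B avg2_avg3.
  apply/funext=> a; apply/funext=> b; apply/funext=> c; apply/funext=> e.
  by rewrite /sub4; ring.
apply/funext=> a; apply/funext=> b; apply/funext=> c; apply/funext=> e.
pose G (z0 z1 z2 z3 : bool) := (-1) ^+ (z0 + z1 + z2 + z3) *
  ((if z0 then @avg1 R A B C E else id) ((if z1 then @avg2 R A B C E else id)
    ((if z2 then @avg3 R A B C E else id) ((if z3 then @avg4 R A B C E else id) f))))
  a b c e.
transitivity (\sum_z0 \sum_z1 \sum_z2 \sum_z3 G z0 z1 z2 z3).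
  rewrite !pair_bigA /centralize (reindex set_of_bits) /=; last first.
    exact: onW_bij set_of_bits_bij.
  apply: eq_bigr => -[[[z0 z1] z2] z3] _.
  by rewrite /avg !inE card_set_of_bits.
rewrite !big_bool /G /center1 /center2 /center3 /center4 !(avg3B, avg2B, avg1B) /sub4 /=.
by rewrite /= !exprS expr0; ring.
Qed.

Let sum_bij (X Y : finType) (h : X -> Y) (F : Y -> R) :
  bijective h -> \sum_x F (h x) = \sum_y F y.
Proof. by move=> hb; rewrite [RHS](reindex h) //; apply: onW_bij. Qed.

Let mulrn_divK (n : nat) (x : R) : (n = 0 -> x = 0) -> x / n%:R *+ n = x.
Proof.
have [->/(_ erefl)->|n0 _] := eqVneq n 0%N; first by rewrite mul0r.
by rewrite -mulr_natr divfK ?pnatr_eq0.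
Qed.

Let sum_center13 f (p : A -> C) b e : bijective p ->
  \sum_a center1 (center3 f) a b (p a) e
    = \sum_a f a b (p a) e - (\sum_a \sum_c f a b c e) / #|A|%:R.
Proof.
move=> pb; rewrite /center1 /center3 avg1B /sub4 !sumrB.
have -> : \sum_a avg3 f a b (p a) e = (\sum_a \sum_c f a b c e) / #|A|%:R.
  by rewrite /avg3 -mulr_suml (bij_eq_card pb).
have -> : \sum_a avg1 f a b (p a) e = (\sum_a \sum_c f a b c e) / #|A|%:R.
  by rewrite /avg1 -mulr_suml (sum_bij (fun c => \sum_a f a b c e)) // exchange_big.
have -> : \sum_a avg1 (avg3 f) a b (p a) e = (\sum_a \sum_c f a b c e) / #|A|%:R.
  rewrite /avg1 /avg3 sumr_const mulrn_divK; last first.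
    by move=> A0; rewrite big1 // => a; case: (fintype0 a A0).
  by rewrite -mulr_suml (bij_eq_card pb).
by rewrite subrr subr0.
Qed.

Let sum_center24 f (p : B -> E) a c : bijective p ->
  \sum_b center2 (center4 f) a b c (p b)
    = \sum_b f a b c (p b) - (\sum_b \sum_e f a b c e) / #|B|%:R.
Proof.
move=> pb; rewrite /center2 /center4 avg2B /sub4 !sumrB.
have -> : \sum_b avg4 f a b c (p b) = (\sum_b \sum_e f a b c e) / #|B|%:R.
  by rewrite /avg4 -mulr_suml (bij_eq_card pb).
have -> : \sum_b avg2 f a b c (p b) = (\sum_b \sum_e f a b c e) / #|B|%:R.
  by rewrite /avg2 -mulr_suml (sum_bij (fun e => \sum_b f a b c e)) // exchange_big.
have -> : \sum_b avg2 (avg4 f) a b c (p b) = (\sum_b \sum_e f a b c e) / #|B|%:R.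
  rewrite /avg2 /avg4 sumr_const mulrn_divK; last first.
    by move=> B0; rewrite big1 // => b; case: (fintype0 b B0).
  by rewrite -mulr_suml (bij_eq_card pb).
by rewrite subrr subr0.
Qed.

(* On the graph of [p1] the averages over the first argument, over the third, and over
   both contribute the same amount; likewise for [p2] and the other two arguments. *)
Lemma sum_centralize_graph f (p1 : A -> C) (p2 : B -> E) :
  bijective p1 -> bijective p2 ->
  \sum_a \sum_b centralize f a b (p1 a) (p2 b)
    = \sum_a \sum_b f a b (p1 a) (p2 b)
      - (\sum_a \sum_b \sum_e f a b (p1 a) e) / #|B|%:R
      - (\sum_a \sum_c \sum_b f a b c (p2 b)) / #|A|%:R
      + (\sum_a \sum_c \sum_b \sum_e f a b c e) / (#|A|%:R * #|B|%:R).
Proof.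
move=> p1b p2b; rewrite centralizeE exchange_big /=.
under eq_bigr => b _ do rewrite sum_center13 //.
rewrite sumrB exchange_big /= -[X in _ - X]mulr_suml.
under eq_bigr => a _ do rewrite sum_center24 //.
have -> : \sum_b \sum_a \sum_c center2 (center4 f) a b c (p2 b)
    = \sum_a \sum_c \sum_b f a b c (p2 b)
      - (\sum_a \sum_c \sum_b \sum_e f a b c e) / #|B|%:R.
  rewrite exchange_big mulr_suml -sumrB; apply: eq_bigr => a _ /=.
  rewrite exchange_big mulr_suml -sumrB; apply: eq_bigr => c _ /=.
  exact: sum_center24.
by rewrite sumrB -mulr_suml invfM; ring.
Qed.

Lemma sum_centralize1 f b c e : \sum_a centralize f a b c e = 0.
Proof.
rewrite centralizeE /center1 /sub4 sumrB [X in _ - X]sumr_const mulrn_divK ?subrr //.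
by move=> A0; rewrite big1 // => a; case: (fintype0 a A0).
Qed.

End CentralizeFactorization.

(** * Splitting a uniform permutation along a set *)

(** The number of bijections sending a to c does not depend on a, by composition with a
    transposition. Exchanging sums therefore leaves a multiple of each column sum. *)
Lemma sum_bijections_graph (R : realType) (A C : finType) (F : A -> C -> R) :
  (forall c, \sum_a F a c = 0) -> \sum_(p in bijections A C) \sum_a F a (p a) = 0.
Proof.
move=> F0; rewrite exchange_big /=.
pose n a c := #|[set p in bijections A C | p a == c]|.
have n_le a a' c : (n a c <= n a' c)%N.
  pose sw (p : {ffun A -> C}) := [ffun x => p (tperm a a' x)].
  have swK : involutive sw by move=> p; apply/ffunP => x; rewrite !ffunE tpermK.
  rewrite /n -(card_imset _ (inv_inj swK)); apply/subset_leq_card/subsetP.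
  move=> _ /imsetP[p + ->]; rewrite !inE => /andP[/asboolP pb pa].
  apply/andP; split; last by rewrite ffunE tpermR.
  apply/asboolP/(eq_bij (bij_comp pb (injF_bij (@perm_inj _ (tperm a a'))))) => x.
  by rewrite ffunE.
have -> : \sum_a \sum_(p in bijections A C) F a (p a) = \sum_a \sum_c F a c *+ n a c.
  apply: eq_bigr => a _.
  rewrite (partition_big (fun p : {ffun A -> C} => p a) xpredT) //=.
  apply: eq_bigr => c _; rewrite -sumr_const; apply: eq_big => p.
    by rewrite !inE.
  by move=> /andP[_ /eqP->].
rewrite exchange_big big1 //= => c _.
have [a0 _|A0] := pickP (fun _ : A => true); last by rewrite big1 // => a; have := A0 a.
rewrite (eq_bigr (fun a => F a c *+ n a0 c)) => [|a _].
  by rewrite sumrMnl F0 mul0rn.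
by congr (_ *+ _); apply/eqP; rewrite eqn_leq !n_le.
Qed.

Lemma card_elt (N : nat) (I : {set 'I_N}) : #|elt I| = #|I|.
Proof. by rewrite card_sig; apply: eq_card => i; rewrite !inE. Qed.

Lemma sum_elt (R : realType) (N : nat) (I : {set 'I_N}) (F : 'I_N -> R) :
  \sum_(x : elt I) F (val x) = \sum_(i in I) F i.
Proof. by rewrite [RHS](big_sub (mem I)). Qed.

Lemma card_bijections (A B : finType) : #|A| = #|B| -> #|bijections A B| = (#|A|)`!.
Proof.
move=> AB; rewrite -ffactnn [in X in X ^_ _]AB -card_inj_ffuns.
apply: eq_card => f; rewrite !inE; apply/asboolP/injectiveP => [/bij_inj //|f_inj].
by apply: inj_card_bij; rewrite ?AB.
Qed.

Section Glue.
Variables (N : nat) (I J : {set 'I_N}).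
Hypothesis cardIJ : #|I| = #|J|.

Let glue_fun (p : {ffun elt I -> elt J} * {ffun elt (~: I) -> elt (~: J)}) :
    {ffun 'I_N -> 'I_N} :=
  [ffun i => if insub i is Some x then val (p.1 x)
             else if insub i is Some y then val (p.2 y) else i].

(** The default permutation [1] is taken only when the glued map is not injective, which
    [glue_fun_inj] excludes on [bij2]. *)
Let glue p : 'S_N := insubd (1%g : 'S_N) (glue_fun p).

Let bij2 := setX (bijections (elt I) (elt J)) (bijections (elt (~: I)) (elt (~: J))).

Let glue_funl p (x : elt I) : glue_fun p (val x) = val (p.1 x).
Proof. by rewrite ffunE valK. Qed.

Let glue_funr p (y : elt (~: I)) : glue_fun p (val y) = val (p.2 y).
Proof.
rewrite ffunE insubN ?valK //.
by have := valP y; rewrite inE.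
Qed.

Let elt_cases (i : 'I_N) : (exists x : elt I, i = val x) \/ (exists y : elt (~: I), i = val y).
Proof.
have [iI|iI] := boolP (i \in I); first by left; exists (Sub i iI).
have iI' : i \in ~: I by rewrite inE.
by right; exists (Sub i iI').
Qed.

Let glue_fun_inj p : p \in bij2 -> injectiveb (glue_fun p).
Proof.
rewrite !inE => /andP[/asboolP b1 /asboolP b2]; apply/injectiveP => i j.
have disj (x : elt I) (y : elt (~: I)) : val (p.1 x) <> val (p.2 y).
  by move=> E; have := valP (p.2 y); rewrite inE -E (valP (p.1 x)).
have [[x ->]|[x ->]] := elt_cases i; have [[y ->]|[y ->]] := elt_cases j;
  rewrite ?glue_funl ?glue_funr.
- by move=> /val_inj /(bij_inj b1) ->.
- by move=> /disj.
- by move=> /esym /disj.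
- by move=> /val_inj /(bij_inj b2) ->.
Qed.

Let glueE p i : p \in bij2 -> glue p i = glue_fun p i.
Proof. by move=> /glue_fun_inj pi; rewrite -pvalE -[pval _]/(val _) val_insubd pi. Qed.

(** Gluing is a bijection from pairs (p1, p2) onto the permutations carrying [I] to [J], with
    restriction as inverse. The relation between [F] and [G] is stated through values, which avoids
    restricted permutations as dependent objects. *)
Lemma sum_perm_imset (R : realType) (G : 'S_N -> R)
    (F : {ffun elt I -> elt J} -> {ffun elt (~: I) -> elt (~: J)} -> R) :
  (forall (s : 'S_N) (p1 : {ffun elt I -> elt J}) (p2 : {ffun elt (~: I) -> elt (~: J)}),
     bijective p1 -> bijective p2 ->
     (forall x, val (p1 x) = s (val x)) -> (forall y, val (p2 y) = s (val y)) ->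
     F p1 p2 = G s) ->
  \sum_(s : 'S_N | s @: I == J) G s
    = \sum_(p1 in bijections (elt I) (elt J))
        \sum_(p2 in bijections (elt (~: I)) (elt (~: J))) F p1 p2.
Proof.
move=> FG.
have cardIJc : #|~: I| = #|~: J| by rewrite cardsCs [#|~: J|]cardsCs !setCK cardIJ.
have glue_inj : {in bij2 &, injective glue}.
  move=> p p' pb pb' E; apply/eqP; rewrite -pair_eqE; apply/andP.
  split; apply/eqP/ffunP => x; apply: val_inj.
    by rewrite -!glue_funl -!glueE // E.
  by rewrite -!glue_funr -!glueE // E.
have -> : \sum_(s : 'S_N | s @: I == J) G s = \sum_(s in glue @: bij2) G s.
  apply: eq_bigl => s; apply/eqP/imsetP => [sIJ|[p pb ->]]; last first.
    apply/eqP; rewrite eqEcard card_imset; last exact: perm_inj.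
    rewrite cardIJ leqnn andbT; apply/subsetP => _ /imsetP[i iI ->].
    rewrite glueE // -[i]/(val (Sub i iI : elt I)) glue_funl.
    exact: valP.
  have sI (x : elt I) : s (val x) \in J by rewrite -sIJ imset_f // (valP x).
  have sIc (y : elt (~: I)) : s (val y) \in ~: J.
    by rewrite inE -sIJ mem_imset; [have := valP y; rewrite inE|exact: perm_inj].
  pose p1 : {ffun elt I -> elt J} := [ffun x => Sub (s (val x)) (sI x)].
  pose p2 : {ffun elt (~: I) -> elt (~: J)} := [ffun y => Sub (s (val y)) (sIc y)].
  have pb : (p1, p2) \in bij2.
    rewrite !inE; apply/andP; split; apply/asboolP/inj_card_bij; rewrite ?card_elt ?cardIJ ?cardIJc //.
      by move=> x y; rewrite !ffunE => /(congr1 val)/= /perm_inj/val_inj.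
    by move=> x y; rewrite !ffunE => /(congr1 val)/= /perm_inj/val_inj.
  exists (p1, p2) => //; apply/permP => i; rewrite glueE //.
  by have [[x ->]|[x ->]] := elt_cases i; rewrite ?glue_funl ?glue_funr ffunE.
rewrite big_imset // pair_big_dep /=; apply: eq_big => [p|p pb]; first by rewrite inE.
have [p1b p2b] : bijective p.1 /\ bijective p.2.
  by move: (pb); rewrite !inE => /andP[/asboolP ? /asboolP ?].
by rewrite (FG (glue p)) // => x; rewrite glueE // ?glue_funl ?glue_funr.
Qed.

End Glue.

(** Permutations are sorted by the image J of [I]. Each J of size [m] receives m! (N - m)! of them,
    so J is uniform and, given J, the two restrictions are independent and uniform. *)
Lemma Eunif_perm_split (R : realType) (N m : nat) (I : {set 'I_N}) (G : 'S_N -> R)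
    (F : forall J : {set 'I_N}, {ffun elt I -> elt J} ->
           {ffun elt (~: I) -> elt (~: J)} -> R) :
  #|I| = m ->
  (forall (J : {set 'I_N}) (s : 'S_N) (p1 : {ffun elt I -> elt J})
          (p2 : {ffun elt (~: I) -> elt (~: J)}),
     #|J| = m -> bijective p1 -> bijective p2 ->
     (forall x, val (p1 x) = s (val x)) -> (forall y, val (p2 y) = s (val y)) ->
     F J p1 p2 = G s) ->
  \E_(J in subsets_of_size N m) \E_(p1 in bijections (elt I) (elt J))
    \E_(p2 in bijections (elt (~: I)) (elt (~: J))) F J p1 p2
  = \E_(s in [set: 'S_N]) G s.
Proof.
move=> cI FG.
have mN : (m <= N)%N by rewrite -cI -[leqRHS]card_ord max_card.
have EJ J : J \in subsets_of_size N m ->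
    \E_(p1 in bijections (elt I) (elt J))
      \E_(p2 in bijections (elt (~: I)) (elt (~: J))) F J p1 p2
    = (\sum_(s : 'S_N | s @: I == J) G s) / (m`! * (N - m)`!)%:R.
  rewrite inE => /eqP cJ; have cIJ : #|I| = #|J| by rewrite cI.
  have cIJc : #|~: I| = #|~: J| by rewrite cardsCs [#|~: J|]cardsCs !setCK cIJ.
  rewrite (sum_perm_imset cIJ (F := F J)) => [|s p1 p2]; last exact: FG.
  rewrite /Eunif -mulr_suml !card_bijections ?card_elt ?cI // cardsCs setCK cI card_ord.
  by rewrite natrM invfM -mulrA [in RHS](mulrC _^-1).
rewrite (eq_Eunif EJ) /Eunif -mulr_suml cardsT card_Sn card_subsets_of_size.
rewrite -mulrA -invfM -natrM mulnC bin_fact //; congr (_ / _).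
rewrite [RHS](partition_big (fun s : 'S_N => s @: I) (mem (subsets_of_size N m))) /=.
  by apply: eq_bigr => J _; apply: eq_bigl => s; rewrite inE.
by move=> s _; rewrite inE card_imset ?cI //; apply: perm_inj.
Qed.

(** * The coupled split statistic *)

Section SplitForm.
Variables (R : realType) (N : nat) (d : tensor R N).

(* [split_stat] for a permutation [s] that maps [I] onto [J]. *)
Definition split_form (m : nat) (I : {set 'I_N}) (s : 'S_N) : R :=
  \sum_(i in I) \sum_(j in ~: I) d i j (s i) (s j)
  - (\sum_(i in I) \sum_(j in ~: I) \sum_(b in ~: I) d i j (s i) (s b)) / (N - m)%:R
  - (\sum_(i in I) \sum_(a in I) \sum_(j in ~: I) d i j (s a) (s j)) / m%:R
  + (\sum_(i in I) \sum_(a in I) \sum_(j in ~: I) \sum_(b in ~: I) d i j (s a) (s b))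
    / (m%:R * (N - m)%:R).

Definition diag_stat (s : 'S_N) : R := \sum_i d i i (s i) (s i).

Definition swap_stat (s : 'S_N) : R := \sum_i \sum_j d i j (s j) (s i).

Definition diag_sum : R := \sum_i \sum_k d i i k k.

Definition sqr_sum : R := \sum_i \sum_j \sum_k \sum_l d i j k l ^+ 2.

Lemma split_statE (m : nat) (I J : {set 'I_N}) (s : 'S_N)
    (p1 : {ffun elt I -> elt J}) (p2 : {ffun elt (~: I) -> elt (~: J)}) :
  #|I| = m -> bijective p1 -> bijective p2 ->
  (forall x, val (p1 x) = s (val x)) -> (forall y, val (p2 y) = s (val y)) ->
  split_stat d p1 p2 = split_form m I s.
Proof.
move=> cI p1b p2b p1s p2s.
have sum1 (F : 'I_N -> R) : \sum_(c : elt J) F (val c) = \sum_(a in I) F (s a).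
  rewrite (reindex p1) /=; last exact: onW_bij.
  by under eq_bigr do rewrite p1s; rewrite (sum_elt _ (fun a => F (s a))).
have sum2 (F : 'I_N -> R) : \sum_(e : elt (~: J)) F (val e) = \sum_(b in ~: I) F (s b).
  rewrite (reindex p2) /=; last exact: onW_bij.
  by under eq_bigr do rewrite p2s; rewrite (sum_elt _ (fun b => F (s b))).
rewrite /split_stat /dtilde sum_centralize_graph // !card_elt [#|~: I|]cardsCs setCK card_ord cI.
rewrite /split_form; congr (_ - _ / _ - _ / _ + _ / _).
- rewrite -(sum_elt _ (fun i => \sum_(j in ~: I) d i j (s i) (s j))).
  apply: eq_bigr => x _; rewrite -(sum_elt _ (fun j => d (val x) j (s (val x)) (s j))).
  by apply: eq_bigr => y _; rewrite p1s p2s.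
- rewrite -(sum_elt _ (fun i => \sum_(j in ~: I) \sum_(b in ~: I) d i j (s i) (s b))).
  apply: eq_bigr => x _.
  rewrite -(sum_elt _ (fun j => \sum_(b in ~: I) d (val x) j (s (val x)) (s b))).
  apply: eq_bigr => y _; rewrite p1s.
  exact: (sum2 (fun b => d (val x) (val y) (s (val x)) b)).
- rewrite -(sum_elt _ (fun i => \sum_(a in I) \sum_(j in ~: I) d i j (s a) (s j))).
  apply: eq_bigr => x _.
  rewrite -(sum1 (fun a => \sum_(j in ~: I) d (val x) j a (s j))).
  apply: eq_bigr => c _.
  rewrite -(sum_elt _ (fun j => d (val x) j (val c) (s j))).
  by apply: eq_bigr => y _; rewrite p2s.
- rewrite -(sum_elt _ (fun i => \sum_(a in I) \sum_(j in ~: I) \sum_(b in ~: I) d i j (s a) (s b))).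
  apply: eq_bigr => x _.
  rewrite -(sum1 (fun a => \sum_(j in ~: I) \sum_(b in ~: I) d (val x) j a (s b))).
  apply: eq_bigr => c _.
  rewrite -(sum_elt _ (fun j => \sum_(b in ~: I) d (val x) j (val c) (s b))).
  apply: eq_bigr => y _.
  exact: (sum2 (fun b => d (val x) (val y) (val c) b)).
Qed.

Lemma Eunif_split_stat (m : nat) (I : {set 'I_N}) (phi : R -> R) : #|I| = m ->
  \E_(J in subsets_of_size N m) \E_(p1 in bijections (elt I) (elt J))
    \E_(p2 in bijections (elt (~: I)) (elt (~: J))) phi (split_stat d p1 p2)
  = \E_(s in [set: 'S_N]) phi (split_form m I s).
Proof.
move=> cI; apply: (Eunif_perm_split cI) => J s p1 p2 cJ p1b p2b p1s p2s.
by rewrite (split_statE (s := s) cI).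
Qed.

(** Back in terms of (J, p1, p2), averaging over [p1] alone already gives 0, since [dtilde] sums to
    zero over its first argument. *)
Lemma Eunif_split_form (m : nat) (I : {set 'I_N}) : #|I| = m ->
  \E_(s in [set: 'S_N]) split_form m I s = 0.
Proof.
move=> cI; rewrite -(Eunif_split_stat id cI) /=.
rewrite /Eunif big1 ?mul0r // => J _.
have := Eunif_exchange (bijections (elt I) (elt J))
  (bijections (elt (~: I)) (elt (~: J))) (fun p1 p2 => split_stat d p1 p2).
rewrite /Eunif => ->; rewrite big1 ?mul0r // => p2 _.
rewrite (sum_bijections_graph (F := fun a c => \sum_b dtilde d a b c (p2 b))) ?mul0r //.
by move=> c; rewrite exchange_big big1 //= => b _; apply: sum_centralize1.
Qed.

(** Composition with a transposition shows that the mean is the same for every [i], and the sum of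
    [f (s i)] over all [i] is deterministic. *)
Lemma Eunif_perm_point (f : 'I_N -> R) (i : 'I_N) :
  \E_(s in [set: 'S_N]) f (s i) = (\sum_k f k) / N%:R.
Proof.
have N_neq0 : N%:R != 0 :> R by rewrite pnatr_eq0; case: (N) i => [[]|].
apply: (mulIf N_neq0); rewrite divfK // mulr_natr -[N in _ *+ N]card_ord -sumr_const.
transitivity (\sum_(j < N) \E_(s in [set: 'S_N]) f (s j)); last first.
  rewrite -Eunif_sum.
  rewrite (eq_Eunif (g := fun=> \sum_k f k)) => [|s _ /=].
    by rewrite Eunif_cst // (setT_neq0 1%g).
  by rewrite [RHS](reindex_perm s).
apply: eq_bigr => j _; rewrite /Eunif (reindex_inj (mulgI (tperm i j))) /=.
congr (_ / _); apply: eq_big => s; first by rewrite !inE.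
by rewrite permM tpermL.
Qed.

(** [diag_stat] is the linear permutation statistic of the matrix d(i, i, k, k), whose squared
    entries are among the terms of [sqr_sum]. *)
Lemma Eunif_diag_le (c : R) :
  \E_(s in [set: 'S_N]) expR (c * (diag_stat s - \E_(t in [set: 'S_N]) diag_stat t))
    <= expR (c ^+ 2 * sqr_sum).
Proof.
have -> : \E_(t in [set: 'S_N]) diag_stat t = diag_sum / N%:R.
  rewrite Eunif_sum mulr_suml; apply: eq_bigr => i _.
  exact: (Eunif_perm_point (fun k => d i i k k)).
have := Eunif_perm_linear_le (fun i k => c * d i i k k).
rewrite (eq_Eunif (g := fun s => expR (c * (diag_stat s - diag_sum / N%:R)))) => [|s _ /=].
  move=> /le_trans; apply; rewrite ler_expR mulr_sumr; apply: ler_sum => i _.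
  rewrite [X in _ <= _ * X](bigD1 i) //= mulrDr ler_wpDr //.
    rewrite mulr_ge0 ?sqr_ge0 //; do 3!(apply: sumr_ge0 => ? _); exact: sqr_ge0.
  rewrite mulr_sumr; apply: ler_sum => k _; rewrite exprMn ler_wpM2l ?sqr_ge0 //.
  by rewrite (bigD1 k) //= lerDl sumr_ge0 // => ? _; apply: sqr_ge0.
rewrite -mulr_sumr; under [X in _ - X / _]eq_bigr => i _ do rewrite -mulr_sumr.
by rewrite -mulr_sumr mulrBr mulrA.
Qed.

(** Cauchy-Schwarz over the N^2 pairs (i, j); each squared term is one of the squares d(i, j, k,
    l)^2 with the same i and j. *)
Lemma swap_stat_le (s : 'S_N) : `|swap_stat s| <= N%:R * Num.sqrt sqr_sum.
Proof.
have -> : N%:R = Num.sqrt (N%:R ^+ 2) :> R by rewrite sqrtr_sqr ger0_norm.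
rewrite -sqrtrM ?sqr_ge0 // -sqrtr_sqr ler_wsqrtr //.
rewrite /swap_stat pair_bigA /=.
apply: le_trans (sqr_sum_le _) _; rewrite card_prod !card_ord natrM -expr2 ler_wpM2l ?sqr_ge0 //.
rewrite -(pair_bigA _ (fun i j => d i j (s j) (s i) ^+ 2)) /=.
apply: ler_sum => i _; apply: ler_sum => j _.
rewrite (bigD1 (s j)) //= (bigD1 (s i)) //= -addrA lerDl addr_ge0 //.
  by apply: sumr_ge0 => ? _; apply: sqr_ge0.
by do 2!(apply: sumr_ge0 => ? _); apply: sqr_ge0.
Qed.

(** Hoeffding's lemma with the uniform bound 2 |c| N sqrt([sqr_sum]). This crude estimate suffices
    because [swap_stat] enters with a weight of order 1 / N^2. *)
Lemma Eunif_swap_le (c : R) :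
  \E_(s in [set: 'S_N]) expR (c * (swap_stat s - \E_(t in [set: 'S_N]) swap_stat t))
    <= expR (2 * (c * N%:R) ^+ 2 * sqr_sum).
Proof.
set u := \E_(t in _) swap_stat t; have T0 := setT_neq0 (1%g : 'S_N).
have u_le : `|u| <= N%:R * Num.sqrt sqr_sum.
  rewrite ler_norml; apply/andP; split.
    rewrite -(Eunif_cst T0 (- _)); apply: Eunif_le => s _.
    by have := swap_stat_le s; rewrite ler_norml => /andP[].
  rewrite -(Eunif_cst T0 (N%:R * _)); apply: Eunif_le => s _.
  by have := swap_stat_le s; rewrite ler_norml => /andP[].
have Q_ge0 : 0 <= sqr_sum by do 4!(apply: sumr_ge0 => ? _); apply: sqr_ge0.
apply: le_trans (_ : expR ((`|c| * (2 * (N%:R * Num.sqrt sqr_sum))) ^+ 2 / 2) <= _).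
  apply: Eunif_Hoeffding => //; first by rewrite EunifZ Eunif_center // mulr0.
  move=> s _; rewrite normrM ler_wpM2l //.
  by rewrite mulr_natl mulr2n (le_trans (ler_normB _ _)) // lerD ?swap_stat_le.
rewrite ler_expR !exprMn sqr_sqrtr // real_normK ?num_real //.
by rewrite le_eqVlt; apply/orP; left; apply/eqP; field.
Qed.

End SplitForm.

(** * Conditional mean of the split form given the permutation *)

Section ConditionalExpectation.
Variables (R : realType) (N m : nat) (d : tensor R N).
Hypotheses (m_ge4 : (4 <= m)%N) (Nm_ge4 : (4 <= N - m)%N) (hd : degenerate d).

Let n : R := N%:R.
Let y : R := m%:R.
Let z : R := (N - m)%:R.

(** With n = N, y = m and z = N - m, this is the probability that two given points lie in I and two
    others outside, divided by y z, the denominator of the last term of [split_form]. *)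
Definition coef_swap (n y z : R) : R :=
  (y - 1) * (z - 1) / (n * (n - 1) * (n - 2) * (n - 3)).

Definition coef_perm (n y z : R) : R :=
  y * z / (n * (n - 1)) - (y * (y - 1) + z * (z - 1)) / (n * (n - 1) * (n - 2))
  + coef_swap n y z.

Definition coef_diag (n y z : R) : R :=
  - (2 * y * z - n) / (n * (n - 1) * (n - 2))
  + (n ^+ 2 + 1 - 5 * y * z) / (n * (n - 1) * (n - 2) * (n - 3)).

Let ffact_natr (k a : nat) : (a <= k)%N ->
  (k ^_ a)%:R = \prod_(i < a) (k%:R - i%:R) :> R.
Proof.
elim: a => [|a IHa] ak; first by rewrite big_ord0.
by rewrite big_ord_recr ffactnSr natrM natrB ?IHa // ltnW.
Qed.

Let incl_probE (k a : nat) : (a <= k)%N -> (k <= N)%N ->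
  incl_prob R N k a = \prod_(i < a) ((k%:R - i%:R) / (n - i%:R)).
Proof.
by move=> ak kN; rewrite /incl_prob !ffact_natr ?prodf_div // (leq_trans ak).
Qed.

(** By degeneracy, a sum over [~: I] of an index that occurs once is minus the sum over [I]. The
    triple sums thus run over a single set, [I] or [~: I], and the quadruple sum over [I], so the
    subset moments apply. In the quadruple sum the pairing i=j, k=l gives [diag_sum], the pairing
    i=k, j=l gives [perm_stat] plus [diag_stat], and i=l, j=k gives [swap_stat]. *)
Lemma Eunif_subset_split_form (s : 'S_N) :
  \E_(I in subsets_of_size N m) split_form d m I s
    = coef_perm n y z * perm_stat d s + coef_diag n y z * diag_stat d s
      + coef_swap n y z * swap_stat d s + coef_swap n y z * diag_sum d.
Proof.
have mN : (m <= N)%N by lia.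
have reidx (F : 'I_N -> R) : \sum_k F (s k) = \sum_k F k.
  by rewrite [RHS](reindex_perm s).
pose g i j k l := d i j (s k) (s l).
have g4 i j k : \sum_l g i j k l = 0.
  by rewrite (reidx (fun l => d i j (s k) l)); have [] := hd i j (s k) i.
have g3 i j l : \sum_k g i j k l = 0.
  by rewrite (reidx (fun k => d i j k (s l))); have [] := hd i j i (s l).
have g2 i k l : \sum_j g i j k l = 0 by have [] := hd i i (s k) (s l).
have g1 j k l : \sum_i g i j k l = 0 by have [] := hd j j (s k) (s l).
have compl (I : {set 'I_N}) (F : 'I_N -> R) : \sum_i F i = 0 ->
    \sum_(i in ~: I) F i = - \sum_(i in I) F i.
  rewrite (bigID (mem I)) /= => /eqP; rewrite addr_eq0 => /eqP ->; rewrite opprK.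
  by apply: eq_bigl => i; rewrite inE.
have compl2 (I : {set 'I_N}) (F : 'I_N -> 'I_N -> R) :
    (forall j, \sum_i F i j = 0) -> (forall i, \sum_j F i j = 0) ->
    \sum_(i in ~: I) \sum_(j in ~: I) F i j = \sum_(i in I) \sum_(j in I) F i j.
  move=> F1 F2; rewrite (eq_bigr _ (fun i _ => compl I _ (F2 i))) sumrN compl ?opprK //.
  by rewrite exchange_big big1 //= => j _; rewrite F1.
have T2 (I : {set 'I_N}) : \sum_(i in I) \sum_(j in ~: I) \sum_(b in ~: I) d i j (s i) (s b)
    = \sum_(i in I) \sum_(j in I) \sum_(b in I) g i j i b.
  by apply: eq_bigr => i _; apply: (compl2 I (fun j b => g i j i b)).
have T3 (I : {set 'I_N}) : \sum_(i in I) \sum_(a in I) \sum_(j in ~: I) d i j (s a) (s j)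
    = \sum_(j in ~: I) \sum_(i in ~: I) \sum_(a in ~: I) g i j a j.
  under eq_bigr => i _ do rewrite exchange_big.
  rewrite exchange_big /=; apply: eq_bigr => j _.
  by rewrite (compl2 I (fun i a => g i j a j)).
have T4 (I : {set 'I_N}) : \sum_(i in I) \sum_(a in I) \sum_(j in ~: I) \sum_(b in ~: I) d i j (s a) (s b)
    = \sum_(i in I) \sum_(j in I) \sum_(a in I) \sum_(b in I) g i j a b.
  apply: eq_bigr => i _; rewrite [RHS]exchange_big; apply: eq_bigr => a _.
  by apply: (compl2 I (fun j b => g i j a b)).
have E1 := Eunif_sum_in2 mN (fun i j => g i j i j).
have E2 := Eunif_sum_in3 mN (fun i b => g2 i i b) (fun i j => g4 i j i).
have E3 := Eunif_sum_in3 (leq_subr m N) (fun j a => g1 j a j) (fun j i => g3 i j j).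
rewrite -(Eunif_setC mN) in E3.
have E4 := Eunif_sum_in4 mN g1 g2 g3 g4.
have full : \sum_i \sum_j g i j i j = perm_stat d s + diag_stat d s.
  rewrite -big_split; apply: eq_bigr => i _ /=; rewrite addrC.
  by rewrite (bigD1 i).
have T : \sum_i \sum_j g i i j j = diag_sum d.
  by apply: eq_bigr => i _; rewrite (reidx (fun k => d i i k k)).
have full' : \sum_x \sum_y g y x y x = perm_stat d s + diag_stat d s.
  by rewrite exchange_big.
have -> : \E_(I in subsets_of_size N m) split_form d m I s =
    \E_(I in subsets_of_size N m) (\sum_(i in I) \sum_(j in ~: I) g i j i j)
    - z^-1 * \E_(I in subsets_of_size N m)
        (\sum_(i in I) \sum_(j in I) \sum_(b in I) g i j i b)
    - y^-1 * \E_(I in subsets_of_size N m)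
        (\sum_(j in ~: I) \sum_(i in ~: I) \sum_(a in ~: I) g i j a j)
    + (y * z)^-1 * \E_(I in subsets_of_size N m)
        (\sum_(i in I) \sum_(j in I) \sum_(a in I) \sum_(b in I) g i j a b).
  rewrite -!mulNr -!EunifZ -!EunifD; apply: eq_Eunif => I _.
  by rewrite /split_form T2 T3 T4 -/y -/z; ring.
rewrite E1 E2 E3 E4 full full' T.
rewrite -[\sum_i \sum_(j | j != i) _]/(perm_stat d s).
rewrite -![\sum_i g i i i i]/(diag_stat d s) -[\sum_i \sum_j g i j j i]/(swap_stat d s).
rewrite !incl_probE ?leq_subr //; try lia.
rewrite !big_ord_recl !big_ord0 /= -/y -/z.
have -> : n = y + z by rewrite /n /y /z -natrD subnKC.
have y_ge4 : 4 <= y by rewrite (ler_nat _ 4).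
have z_ge4 : 4 <= z by rewrite (ler_nat _ 4).
rewrite /coef_perm /coef_diag /coef_swap.
move: (perm_stat d s) (diag_stat d s) (swap_stat d s) (diag_sum d) => W L U D.
rewrite /bump /=.
by field; do ?[apply/andP; split]; apply: lt0r_neq0; lra.
Qed.

End ConditionalExpectation.

(** In terms of t = n - 20 >= 0 and u = (y - z)^2 in [0, 1], with y z = (n^2 - u) / 4, clearing the
    denominator [D] leaves inequalities that are linear in the monomials t^k and t^k u. The bound 2
    / 9 serves to get 2 / alpha <= 9; the constants 5 / 2 and 5 / 4 are fixed by the exponent 100 V
    lambda^2 of the remainder. *)
Lemma coef_bounds (R : realType) (n y z : R) :
  n = y + z -> 20 <= n -> 0 <= y - z <= 1 ->
  [/\ 2 / 9 <= coef_perm n y z,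
      `|coef_diag n y z| * n <= 5 / 2 * coef_perm n y z
    & `|coef_swap n y z| * n ^+ 2 <= 5 / 4 * coef_perm n y z].
Proof.
move=> n_def n_ge /andP[yz_ge0 yz_le1].
pose t := n - 20; pose u := (y - z) ^+ 2.
have t_ge0 : 0 <= t by rewrite /t; lra.
have u_ge0 : 0 <= u by rewrite sqr_ge0.
have u_le1 : u <= 1 by rewrite /u expr2; nra.
have nE : n = t + 20 by rewrite /t; ring.
have yzE : y * z = (n ^+ 2 - u) / 4 by rewrite n_def /u; field.
pose D := n * (n - 1) * (n - 2) * (n - 3).
have D_gt0 : 0 < D by rewrite /D !mulr_gt0 // nE; lra.
have D_neq0 : D != 0 by apply: lt0r_neq0.
have aE : coef_perm n y z = (y * z * (n - 2) * (n - 3)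
    - (n ^+ 2 - 2 * (y * z) - n) * (n - 3) + (y * z - n + 1)) / D.
  rewrite /coef_perm /coef_swap /D; rewrite n_def.
  by field; do ?[apply/andP; split]; apply: lt0r_neq0; rewrite -?n_def; lra.
have bE : coef_diag n y z = (- (2 * (y * z) - n) * (n - 3)
    + (n ^+ 2 + 1 - 5 * (y * z))) / D.
  rewrite /coef_diag /D; rewrite n_def.
  by field; do ?[apply/andP; split]; apply: lt0r_neq0; rewrite -?n_def; lra.
have cE : coef_swap n y z = (y * z - n + 1) / D.
  by rewrite /coef_swap /D; congr (_ / _); rewrite n_def; ring.
rewrite aE bE cE yzE nE.
have t2 : 0 <= t ^+ 2 by rewrite exprn_ge0.
have t3 : 0 <= t ^+ 3 by rewrite exprn_ge0.
have t4 : 0 <= t ^+ 4 by rewrite exprn_ge0.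
have tu : 0 <= t * u <= t by rewrite mulr_ge0 //=; nra.
have t2u : 0 <= t ^+ 2 * u <= t ^+ 2 by rewrite mulr_ge0 //=; nra.
have t3u : 0 <= t ^+ 3 * u <= t ^+ 3 by rewrite mulr_ge0 //=; nra.
split.
- rewrite ler_pdivlMr // /D nE. lra.
- rewrite normrM normfV (gtr0_norm D_gt0) mulrAC [leRHS]mulrA ler_pM2r ?invr_gt0 //.
  rewrite -ler_pdivlMr ?ler_norml; last lra.
  rewrite -mulNr ler_pdivlMr ?ler_pdivrMr; try lra.
- rewrite normrM normfV (gtr0_norm D_gt0) mulrAC [leRHS]mulrA ler_pM2r ?invr_gt0 //.
  rewrite ger0_norm; last lra.
  lra.
Qed.

(** * Decoupling inequality for the exponential moment *)

Theorem theorem2p1 (R : realType) (N : nat) (hN : (20 <= N)%N)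
    (d : tensor R N) (hd : degenerate d) (lambda : R) (hlambda : 0 <= lambda) :
  \E_(p in [set: 'S_N])
     expR (lambda * (perm_stat d p - \E_(q in [set: 'S_N]) perm_stat d q))
  <= expR (50 * Vtilde d * lambda ^+ 2)
     * Num.sqrt
         (\E_(I in subsets_of_size N (uphalf N))
          \E_(J in subsets_of_size N (uphalf N))
          \E_(p1 in bijections (elt I) (elt J))
          \E_(p2 in bijections (elt (~: I)) (elt (~: J)))
            expR (9 * lambda * split_stat d p1 p2)).
Proof.
set m := uphalf N; set n : R := N%:R; set y : R := m%:R; set z : R := (N - m)%:R.
(* The two block sizes differ by the parity of N, hence by at most 1. *)
have NE : N = (odd N + N./2 + N./2)%N by rewrite -addnA addnn odd_double_half.
have mE : m = (odd N + N./2)%N by rewrite /m uphalf_half.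
have zE : (N - m = N./2)%N by rewrite mE {1}NE addKn.
have b1 : (odd N <= 1)%N by case: (odd N).
have n_def : n = y + z by rewrite /n /y /z -natrD subnKC //; lia.
have n_ge : 20 <= n by rewrite (ler_nat _ 20).
have yz : 0 <= y - z <= 1.
  by rewrite /y /z zE mE natrD addrK ler0n (ler_nat _ _ 1).
have [alpha_ge beta_le gamma_le] := coef_bounds n_def n_ge yz.
pose alpha := coef_perm n y z; pose beta := coef_diag n y z; pose gamma := coef_swap n y z.
rewrite -/alpha -/beta -/gamma in alpha_ge beta_le gamma_le.
have alpha_gt0 : 0 < alpha by lra.
have S0 := setT_neq0 (1%g : 'S_N).
have I0 : subsets_of_size N m != finset.set0 by apply: subsets_of_size_neq0; lia.
set M := \E_(I in subsets_of_size N m) _.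
have ME : M = \E_(I in subsets_of_size N m) \E_(s in [set: 'S_N])
    expR (9 * lambda * split_form d m I s).
  apply: eq_Eunif => I; rewrite inE => /eqP cI.
  exact: (Eunif_split_stat d (fun x => expR (9 * lambda * x))).
pose h (s : 'S_N) := \E_(I in subsets_of_size N m) split_form d m I s.
have hE s : h s = alpha * perm_stat d s + beta * diag_stat d s + gamma * swap_stat d s
    + gamma * diag_sum d.
  by apply: Eunif_subset_split_form => //; lia.
set w := Eunif _ (perm_stat d).
pose l := Eunif [set: 'S_N] (diag_stat d); pose u := Eunif [set: 'S_N] (swap_stat d).
(* Every split form has mean zero, so averaging [hE] over permutations determines the constant
   term. *)
have hmean : alpha * w + beta * l + gamma * u + gamma * diag_sum d = 0.
  rewrite -!EunifZ -(Eunif_cst S0 (gamma * diag_sum d)) -!EunifD -(eq_Eunif (fun s _ => hE s)).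
  rewrite /h Eunif_exchange -[RHS](Eunif_cst I0); apply: eq_Eunif => I.
  by rewrite inE => /eqP; apply: Eunif_split_form.
(* The weights obtained by solving [hE] for [perm_stat]; [hmean] absorbs the constant into the
   centering. *)
pose a := - (lambda * beta / alpha); pose b := - (lambda * gamma / alpha).
pose X s := expR (lambda / alpha * h s).
pose Y s := expR (a * (diag_stat d s - l) + b * (swap_stat d s - u)).
have XY s : expR (lambda * (perm_stat d s - w)) = X s * Y s.
  rewrite /X /Y -expRD; congr expR; rewrite hE /a /b.
  have -> : w = - (beta * l + gamma * u + gamma * diag_sum d) / alpha.
    by apply: (mulIf (lt0r_neq0 alpha_gt0)); rewrite divfK ?lt0r_neq0 //; lra.
  by field; apply: lt0r_neq0.
have XM : \E_(s in [set: 'S_N]) X s ^+ 2 <= M.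
  (* Squaring [X] gives the factor 2 lambda / alpha = r * (9 lambda), and r <= 1 is exactly alpha >=
     2 / 9. *)
  pose r := 2 / (9 * alpha).
  have r01 : 0 <= r <= 1.
    by rewrite /r divr_ge0 ?ler_pdivrMr ?mulr_ge0 ?mulr_gt0 //; lra.
  apply: le_trans (_ : \E_(s in [set: 'S_N]) \E_(I in subsets_of_size N m)
      expR (r * (9 * lambda * split_form d m I s)) <= _).
    apply: Eunif_le => s _; apply: le_trans (Eunif_expR_ge I0 _).
    rewrite EunifZ EunifZ -/(h s) /X expr2 -expRD ler_expR le_eqVlt; apply/orP; left.
    by apply/eqP; rewrite /r; field; apply: lt0r_neq0.
  rewrite Eunif_exchange ME; apply: Eunif_le => I; rewrite inE => /eqP cI.
  apply: Eunif_expR_mono => //.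
  by rewrite EunifZ Eunif_split_form ?mulr0.
pose V := Vtilde d.
have QV : sqr_sum d = V * n ^+ 2.
  by rewrite /V /Vtilde divfK // expf_neq0 // lt0r_neq0 // /n; lra.
have V_ge0 : 0 <= V.
  by rewrite /V /Vtilde divr_ge0 ?sqr_ge0 //; do 4!(apply: sumr_ge0 => ? _); apply: sqr_ge0.
(* The two statistics are dependent. Convexity with weights 1 / 2 separates them, at the price of
   doubling the factors 2 a and 2 b. *)
have YV : \E_(s in [set: 'S_N]) Y s ^+ 2 <= expR (50 * V * lambda ^+ 2) ^+ 2.
  apply: le_trans (_ : \E_(s in [set: 'S_N])
      (1 / 2 * expR (4 * a * (diag_stat d s - l))
       + (1 - 1 / 2) * expR (4 * b * (swap_stat d s - u))) <= _).
    apply: Eunif_le => s _; rewrite /Y expr2 -expRD.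
    apply: le_trans (expR_convex _ _ _); last by lra.
    by rewrite ler_expR le_eqVlt; apply/orP; left; apply/eqP; field.
  rewrite EunifD !EunifZ.
  have A := Eunif_diag_le d (4 * a).
  have B := Eunif_swap_le d (4 * b).
  have E : expR (50 * V * lambda ^+ 2) ^+ 2 = expR (100 * V * lambda ^+ 2).
    by rewrite expr2 -expRD; congr expR; ring.
  have lal : 0 <= lambda / alpha by rewrite divr_ge0 // ltW.
  (* Here 16 * (5 / 2)^2 = 100. *)
  have A' : (4 * a) ^+ 2 * sqr_sum d <= 100 * V * lambda ^+ 2.
    have : `|beta| * n * (lambda / alpha) <= 5 / 2 * lambda.
      apply: le_trans (ler_wpM2r lal beta_le) _.
      by rewrite le_eqVlt; apply/orP; left; apply/eqP; field; apply: lt0r_neq0.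
    rewrite -ler_sqr ?nnegrE; [|by rewrite mulr_ge0 // mulr_ge0|by lra].
    rewrite !exprMn real_normK ?num_real // => /(ler_wpM2r V_ge0) H.
    rewrite QV; apply: le_trans (le_trans _ (ler_wpM2l (ler0n R 16) H)) _; last lra.
    by rewrite /a le_eqVlt; apply/orP; left; apply/eqP; field; apply: lt0r_neq0.
  (* Here 32 * (5 / 4)^2 = 50, within the allowance of 100. *)
  have B' : 2 * (4 * b * n) ^+ 2 * sqr_sum d <= 100 * V * lambda ^+ 2.
    have : `|gamma| * n ^+ 2 * (lambda / alpha) <= 5 / 4 * lambda.
      apply: le_trans (ler_wpM2r lal gamma_le) _.
      by rewrite le_eqVlt; apply/orP; left; apply/eqP; field; apply: lt0r_neq0.
    rewrite -ler_sqr ?nnegrE; [|by rewrite mulr_ge0 // mulr_ge0 ?sqr_ge0|by lra].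
    rewrite !exprMn real_normK ?num_real // => /(ler_wpM2r V_ge0) H.
    rewrite QV; apply: le_trans (le_trans _ (ler_wpM2l (ler0n R 32) H)) _; last first.
      have : 0 <= V * lambda ^+ 2 by rewrite mulr_ge0 ?sqr_ge0.
      lra.
    by rewrite /b le_eqVlt; apply/orP; left; apply/eqP; field; apply: lt0r_neq0.
  rewrite E; rewrite -/l in A; rewrite -/u -/n in B.
  have := le_trans A (_ : _ <= expR (100 * V * lambda ^+ 2)).
  rewrite ler_expR => /(_ A') A''.
  have := le_trans B (_ : _ <= expR (100 * V * lambda ^+ 2)).
  rewrite ler_expR => /(_ B') B''.
  lra.
rewrite (eq_Eunif (fun s _ => XY s)).
have E_ge0 : 0 <= \E_(s in [set: 'S_N]) (X s * Y s).
  by apply: Eunif_ge0 => s _; rewrite mulr_ge0 ?expR_ge0.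
have M_ge0 : 0 <= M by apply: le_trans XM; apply: Eunif_ge0 => s _; apply: sqr_ge0.
rewrite -ler_sqr ?nnegrE //; last by rewrite mulr_ge0 ?expR_ge0 ?sqrtr_ge0.
rewrite [leRHS]exprMn sqr_sqrtr // [leRHS]mulrC.
apply: le_trans (Eunif_CauchySchwarz _ _ _) _; apply: ler_pM => //.
- by apply: Eunif_ge0 => s _; apply: sqr_ge0.
- by apply: Eunif_ge0 => s _; apply: sqr_ge0.
Qed.
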